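(* Let $\mu,\nu$ be Radon measures on $\mathbb R^d$ without common atoms, let $1<p<\infty$, and let $K\in L^2_{\mathrm{loc}}(\mu\times\nu)$ (locally square integrable on all of $\mathbb R^d\times\mathbb R^d$, including near the diagonal) be $L^p(\mu)\to L^p(\nu)$ restrictedly bounded with restricted norm $C$. Then the integral operator $Tf(x)=\int K(x,y)f(y)\,d\mu(y)$, defined for bounded compactly supported $f$, satisfies $\|Tf\|_{L^p(\nu)}\le 2C\|f\|_{L^p(\mu)}$, so it extends to a bounded operator $L^p(\mu)\to L^p(\nu)$ of norm at most $2C$.
   Context: $K$ is $L^p(\mu)\to L^p(\nu)$ restrictedly bounded if there is $C$ such that for all $f\in L^\infty(\mu)$, $g\in L^\infty(\nu)$ with separated (disjoint) compact supports, $\left|\iint K(x,y)f(y)g(x)\,d\mu(y)\,d\nu(x)\right|\le C\|f\|_{L^p(\mu)}\|g\|_{L^{p'}(\nu)}$, $1/p+1/p'=1$; the best such $C$ is the restricted norm. *)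

(* Defs.v *)
From HB Require Import structures.
From mathcomp Require Import all_boot all_order all_algebra.
From mathcomp Require Import all_classical all_reals all_analysis.
Set Implicit Arguments. Unset Strict Implicit. Unset Printing Implicit Defensive.
Import Order.TTheory GRing.Theory Num.Theory.
Import numFieldNormedType.Exports.
Local Open Scope classical_set_scope.
Local Open Scope ring_scope.

Definition Rd (R : realType) (d : nat) :=
  g_sigma_algebraType (@open 'rV[R]_d).

HB.instance Definition _ (R : realType) (d : nat) :=
  Measurable.on (Rd R d).

Lemma RdE (R : realType) (d : nat) :
  (measurable : set (set (Rd R d))) = <<s (@open 'rV[R]_d) >>.
Proof. by []. Qed.

Definition radon (R : realType) (d : nat) (mu : set (Rd R d) -> \bar R) :=
  forall A : set 'rV[R]_d, compact A -> (mu A < +oo)%E.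

Definition no_common_atoms (R : realType) (d : nat)
    (mu nu : set (Rd R d) -> \bar R) :=
  forall x : Rd R d, mu [set x] = 0%E \/ nu [set x] = 0%E.

(* K in L^2_loc(nu x mu) on all of R^d x R^d  (variables (x, y), x ~ nu, y ~ mu). *)
Definition L2loc (R : realType) (d : nat)
    (nu : {measure set (Rd R d) -> \bar R})
    (mu : {sigma_finite_measure set (Rd R d) -> \bar R})
    (K : Rd R d * Rd R d -> R) :=
  measurable_fun setT K /\
  forall Q : set ('rV[R]_d * 'rV[R]_d), compact Q ->
    (\int[(nu \x mu)%E]_(z in (Q : set (Rd R d * Rd R d))) (`|K z| ^+ 2)%:E
       < +oo)%E.

Definition bdd_supported_in (R : realType) (d : nat) (f : Rd R d -> R)
    (A : set 'rV[R]_d) :=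
  measurable_fun setT f /\ (exists M : R, forall x, `|f x| <= M) /\
  (forall x, ~ A x -> f x = 0).

Definition conj_exp (R : realType) (p : R) : R := p / (p - 1).

Definition restrictedly_bounded (R : realType) (d : nat)
    (mu : {sigma_finite_measure set (Rd R d) -> \bar R})
    (nu : {measure set (Rd R d) -> \bar R})
    (p : R) (K : Rd R d * Rd R d -> R) (C : R) :=
  forall (f g : Rd R d -> R) (A B : set 'rV[R]_d),
    compact A -> compact B -> A `&` B = set0 ->
    bdd_supported_in f A -> bdd_supported_in g B ->
    (`| \int[(nu \x mu)%E]_z (K z * f z.2 * g z.1)%:E |
      <= C%:E * Lnorm mu p%:E (EFin \o f)
              * Lnorm nu (conj_exp p)%:E (EFin \o g))%E.

Definition intop (R : realType) (d : nat)
    (mu : {sigma_finite_measure set (Rd R d) -> \bar R})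
    (K : Rd R d * Rd R d -> R) (f : Rd R d -> R) : Rd R d -> R :=
  fun x => fine (\int[mu]_y (K (x, y) * f y)%:E)%E.

(* Main.v *)
Require Import Defs.
From HB Require Import structures.
From mathcomp Require Import all_boot all_order all_algebra.
From mathcomp Require Import all_classical all_reals all_analysis.
From mathcomp Require Import measurable_realfun ring lra.
Set Implicit Arguments. Unset Strict Implicit. Unset Printing Implicit Defensive.
Import Order.TTheory GRing.Theory Num.Theory.
Import numFieldNormedType.Exports.
Local Open Scope classical_set_scope.
Local Open Scope ring_scope.

(** Write [Phi(x, y) = K(x, y) f(y) g(x)], [q] for the exponent conjugate to [p]
    and [c = 2 C (|f|_p^p / p + |g|_q^q / q)].

    If [r] takes the values 1 and -1 and is a pointwise limit of continuous
    functions [h_n], then [{h_n >= 1/2}] and [{h_n <= -1/2}] are disjoint closed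
    sets converging to [{r = 1}] and [{r = -1}], so the restricted bound, combined
    with Young's inequality, passes to [f 1_{r = 1}] and [g 1_{r = -1}]. Adding the
    bounds for [r] and [-r] gives [|int Phi (1 - r(x) r(y))| <= c].

    The set of kernels [k] with [|int Phi (1 - k)| <= c] is convex. Averaging
    [r(x) r(y)] over the [2^n] products [r] of subfamilies of signs [s_i], [i < n],
    gives [prod_{i < n} (1 + s_i(x) s_i(y)) / 2], which converges to the indicator
    of the diagonal when the [s_i] separate points, as half-spaces with rational
    thresholds do. The diagonal is null because there are no common atoms, so
    [|int Phi| <= c].

    Duality against [g] proportional to [Tf |Tf|^(p - 2)], truncated to a set where
    it is bounded and compactly supported, concludes; the proportionality factor
    optimizes Young's inequality. *)

(** * Dominated convergence and countability of atoms *)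

Lemma integrable_le_norm d (T : measurableType d) (R : realType)
    (mu : {measure set T -> \bar R}) (u G : T -> R) :
  measurable_fun setT u -> mu.-integrable setT (EFin \o G) ->
  (forall x, `|u x| <= `|G x|) -> mu.-integrable setT (EFin \o u).
Proof.
move=> mu_ iG uG; apply: (le_integrable measurableT _ _ iG).
  exact/measurable_EFinP.
by move=> x _; rewrite /= lee_fin.
Qed.

Lemma cvg_Rintegral d (T : measurableType d) (R : realType)
    (mu : {measure set T -> \bar R}) (u : nat -> T -> R) (v G : T -> R) :
  (forall n, measurable_fun setT (u n)) -> mu.-integrable setT (EFin \o G) ->
  (forall n x, `|u n x| <= `|G x|) ->
  (forall x, u^~ x @ \oo --> v x) ->
  (\int[mu]_x u n x)%R @[n --> \oo] --> (\int[mu]_x v x)%R.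
Proof.
move=> mu_ iG uG uv.
have mv : measurable_fun setT v by apply: measurable_fun_cvg mu_ _ => x _.
have [iv _ c] : [/\ mu.-integrable setT (EFin \o v),
    [sequence \int[mu]_x `|(u n x)%:E - (v x)%:E|]_n @ \oo --> 0 &
    [sequence \int[mu]_x (u n x)%:E]_n @ \oo --> \int[mu]_x (v x)%:E]%E.
  apply: (@dominated_convergence _ _ _ mu setT measurableT
    (fun n => EFin \o u n) (EFin \o v) (EFin \o (fun x => `|G x|))).
  - by move=> n; exact/measurable_EFinP.
  - exact/measurable_EFinP.
  - by apply: aeW => x _; apply: cvg_EFin; [exact: nearW|exact: uv].
  - exact: (integrable_norm iG).
  - by apply: aeW => x n _; rewrite /= lee_fin.
rewrite /Rintegral; apply: fine_cvg.
by rewrite fineK//; exact: integrable_fin_num.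
Qed.

(** Sort the atoms by mass: only finitely many points of [A] can have mass above [1/(n+1)], since an
    infinite family of them would force [mu A] to be infinite. *)
Lemma countable_atoms d (T : measurableType d) (R : realType)
    (mu : {measure set T -> \bar R}) (A : set T) :
  (forall x, measurable [set x : T]) -> measurable A -> (mu A < +oo)%E ->
  countable [set x | A x /\ mu [set x] != 0%E].
Proof.
move=> m1 mA Aoo.
have fin x : A x -> mu [set x] \is a fin_num.
  move=> Ax; rewrite ge0_fin_numE//; apply: le_lt_trans Aoo.
  by apply: le_measure; rewrite ?inE// => y ->.
rewrite [X in countable X](_ : _ =
    \bigcup_n [set x | A x /\ n.+1%:R^-1 < fine (mu [set x])]); last first.
  apply/seteqP; split=> [x/= [Ax mx]|x/= [k _ [Ax kx]]].
    have : 0 < fine (mu [set x]).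
      by rewrite fine_gt0// lt0e mx measure_ge0/= -ge0_fin_numE// fin.
    by move=> /ltr_add_invr[k /[!add0r] kXr]; exists k.
  split => //; apply/eqP => mx0; move: kx; rewrite mx0/= ltNge => /negP; apply.
  by rewrite invr_ge0.
apply: bigcup_countable => // n _; apply: finite_set_countable.
apply: contrapT => /infiniteP/pcard_leP/injfunPex[/= q q_fun q_inj].
have mU : measurable (\bigcup_k [set q k]) by apply: bigcup_measurable => k _.
have tq : trivIset setT (fun k => [set q k]).
  apply/trivIsetP => i j _ _ /eqP ij; rewrite -subset0 => x [-> qij].
  by apply: ij; apply: q_inj; rewrite ?inE.
have big k : (mu A >= (k%:R / n.+1%:R)%:E)%E.
  apply: (@le_trans _ _ (mu (\bigcup_k [set q k]))); last first.
    by apply: le_measure; rewrite ?inE// => x [j _ ->]; have [] := q_fun j I.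
  rewrite measure_bigcup//; apply: (le_trans _ (nneseries_lim_ge k _)) => //.
  rewrite (_ : (k%:R / n.+1%:R)%:E = \sum_(0 <= j < k) n.+1%:R^-1%:E)%E; last first.
    by rewrite sumEFin sumr_const_nat subn0 mulr_natl.
  under [leRHS]eq_bigl do rewrite in_setT; apply: lee_sum => j _.
  have [Aq qn] := q_fun j I.
  by rewrite -(fineK (fin _ Aq)) lee_fin ltW.
(* Any [k] larger than [mu A * (n+1)] now contradicts [big]. *)
have Afin : mu A \is a fin_num by rewrite ge0_fin_numE.
have := big (Num.truncn (fine (mu A) * n.+1%:R)).+1.
rewrite leNgt => /negP; apply.
by rewrite -(fineK Afin) lte_fin ltr_pdivlMr//= truncnS_gt.
Qed.

(** * Signs of the first Baire class *)

Section euclidean.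
Context {R : realType} {d : nat}.
Implicit Types (A B : set 'rV[R]_d) (f g r : Rd R d -> R).

Lemma open_measurable_Rd A : open A -> measurable (A : set (Rd R d)).
Proof. by move=> oA; apply: sub_sigma_algebra. Qed.

Lemma closed_measurable_Rd A : closed A -> measurable (A : set (Rd R d)).
Proof.
by move=> /closed_openC/open_measurable_Rd/measurableC; rewrite setCK.
Qed.

Lemma compact_measurable_Rd A : compact A -> measurable (A : set (Rd R d)).
Proof.
by move=> cA; apply: closed_measurable_Rd; exact: compact_closed cA.
Qed.

Lemma measurable_set1_Rd (x : Rd R d) : measurable [set x].
Proof. exact: compact_measurable_Rd (@compact_set1 'rV[R]_d x). Qed.

Lemma continuous_measurable_Rd (h : 'rV[R]_d -> R) :
  continuous h -> measurable_fun setT (h : Rd R d -> R).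
Proof.
move=> ch; apply: (measurability _ (RGenOInfty.measurableE R)).
move=> /= _ [_ [a ->]] <-; rewrite setTI; apply: open_measurable_Rd.
by move/continuousP : ch; apply; exact: rray_open.
Qed.

(* Not merely Borel: this makes [{r = 1}] and [{r = -1}] limits of disjoint closed
   sets without any inner regularity of the measures. *)
Definition baire_sign r :=
  (forall x, r x = 1 \/ r x = -1) /\
  exists h : nat -> 'rV[R]_d -> R,
    (forall n, continuous (h n)) /\ (forall x, h^~ x @ \oo --> r x).

Lemma measurable_baire_sign {r} : baire_sign r -> measurable_fun setT r.
Proof.
move=> [_ [h [ch hr]]].
apply: (@measurable_fun_cvg _ _ _ _ (h : nat -> Rd R d -> R)) => [n|x _].
  exact: continuous_measurable_Rd.
exact: hr.
Qed.

Lemma baire_sign1 : baire_sign (fun=> 1).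
Proof.
split; first by left.
exists (fun=> cst 1); split=> [n|x]; first exact: cst_continuous.
exact: cvg_cst.
Qed.

Lemma baire_signN r : baire_sign r -> baire_sign (fun x => - r x).
Proof.
move=> [r1 [h [ch hr]]]; split=> [x|].
  by case: (r1 x) => ->; [right|left; rewrite opprK].
exists (fun n x => - h n x); split=> [n x|x]; last exact: cvgN (hr x).
by apply: continuousN; exact: ch.
Qed.

Lemma baire_signM r r' :
  baire_sign r -> baire_sign r' -> baire_sign (fun x => r x * r' x).
Proof.
move=> [r1 [h [ch hr]]] [r1' [h' [ch' hr']]]; split=> [x|].
  by case: (r1 x) => ->; case: (r1' x) => ->; rewrite ?mul1r ?mulr1 ?mulN1r ?opprK; auto.
exists (fun n x => h n x * h' n x); split=> [n x|x]; last exact: cvgM (hr x) (hr' x).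
by apply: continuousM; [exact: ch|exact: ch'].
Qed.

Definition halfspace_sign (j : 'I_d) (q : rat) (x : Rd R d) : R :=
  if (x : 'rV[R]_d) 0 j < ratr q then -1 else 1.

Lemma baire_halfspace_sign j q : baire_sign (halfspace_sign j q).
Proof.
split=> [x|]; first by rewrite /halfspace_sign; case: ifP; auto.
pose u : 'rV[R]_d -> R := fun x => x 0 j.
(* Ramps of slope [n] that equal 1 for [x_j >= q] and are cut off at -1. At each fixed point they
   are eventually equal to the sign, although the transition zone always touches the hyperplane. *)
exists (fun n => cst (-1) \max (cst 1 - cst n%:R \* (cst 0 \max (cst (ratr q) - u)))).
split=> [n x|x].
  apply: continuous_max; first exact: cst_continuous.
  apply: continuousB; first exact: cst_continuous.
  apply: continuousM; first exact: cst_continuous.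
  apply: continuous_max; first exact: cst_continuous.
  by apply: continuousB; [exact: cst_continuous|exact: coord_continuous].
change ((fun n : nat => Num.max (-1) (1 - n%:R * Num.max 0 (ratr q - x 0 j)))
  @ \oo --> halfspace_sign j q x).
apply: cvg_near_cst; rewrite /halfspace_sign; case: ltP => xq; last first.
  apply: nearW => n /=; rewrite (@max_idPl _ _ 0 _ _) ?subr_le0//. rewrite mulr0 subr0.
  by apply/max_idPr; lra.
have e0 : 0 < ratr q - x 0 j by rewrite subr_gt0.
near=> n => /=; rewrite (@max_idPr _ _ 0 _ _) ?(ltW e0)//; apply/max_idPl.
suff : 2 <= n%:R * (ratr q - x 0 j) by lra.
rewrite -ler_pdivrMr//; near: n; exact: nbhs_infty_ger.
Unshelve. all: by end_near. Qed.

Lemma halfspace_sign_separates (x y : Rd R d) : x <> y ->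
  exists j q, halfspace_sign j q x * halfspace_sign j q y = -1.
Proof.
move=> xy.
have [j xyj] : exists j, (x : 'rV[R]_d) 0 j != (y : 'rV[R]_d) 0 j.
  by apply: contrapT => /forallNP h; apply: xy; apply/rowP => j; apply/eqP/negPn/negP/h.
exists j; rewrite /halfspace_sign; case/lt_total/orP : xyj => /rat_in_itvoo[q];
  rewrite in_itv/= => /andP[h1 h2]; exists q.
- by rewrite h1 ltNge (ltW h2)/= mulr1.
- by rewrite h1 ltNge (ltW h2)/= mul1r.
Qed.

End euclidean.

(** * Bounded functions with compact support *)

Section compact_support.
Context {R : realType} {d : nat}.
Implicit Types (A B : set 'rV[R]_d) (f g : Rd R d -> R).
Implicit Types mu : {measure set (Rd R d) -> \bar R}.

Lemma bdd_supported_indic f A D : closed D -> bdd_supported_in f A ->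
  bdd_supported_in (fun x : Rd R d => f x * \1_(D : set (Rd R d)) x) (A `&` D).
Proof.
move=> /closed_measurable_Rd mD [mf [[M fM] f0]]; split; last split.
- by apply: measurable_funM => //; exact: measurable_indic.
- exists M => x; rewrite normrM (le_trans _ (fM x))// ler_piMr//.
  by rewrite indicE normr_nat; case: (_ \in _).
- move=> x /not_andP[/f0 ->|nDx]; first by rewrite mul0r.
  by rewrite indicE memNset// mulr0.
Qed.

Lemma bdd_supported_powR f A p : 0 < p -> bdd_supported_in f A ->
  bdd_supported_in (fun x => `|f x| `^ p) A.
Proof.
move=> p0 [mf [[M fM] f0]]; split; last split.
- apply: (measurableT_comp (measurable_powR p)); exact: measurableT_comp.
- exists (M `^ p) => x; rewrite ger0_norm ?powR_ge0//.
  by apply: ge0_ler_powR; rewrite ?nnegrE ?(ltW p0)// (le_trans _ (fM x)).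
- by move=> x /f0 ->; rewrite normr0 powR0// gt_eqF.
Qed.

Lemma bdd_supported_integrable mu f A : radon mu -> compact A ->
  bdd_supported_in f A -> mu.-integrable setT (EFin \o f).
Proof.
move=> rmu cA [mf [[M fM] f0]]; have mA := compact_measurable_Rd cA.
have i1 : mu.-integrable setT (EFin \o \1_(A : set (Rd R d))).
  apply/integrableP; split; first exact/measurable_EFinP/measurable_indic.
  under eq_integral do rewrite /= ger0_norm//.
  by rewrite integral_indic// setIT rmu.
apply: (@integrable_le_norm _ _ _ _ _ (fun x => M * \1_(A : set (Rd R d)) x)) => //.
  exact: eq_integrable (integrableZl measurableT M i1).
move=> x; rewrite indicE; have [Ax|nAx] := pselect ((A : set (Rd R d)) x).
  by rewrite mem_set// mulr1 (le_trans (fM x))// ler_norm.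
by rewrite memNset// f0// normr0.
Qed.

(** Taken in [R] so that limits and absorption of terms are real arithmetic. It is applied to
    bounded functions with compact support, for which a Radon measure makes the integral finite. *)
Definition Lp_int mu (p : R) f : R := (\int[mu]_x (`|f x| `^ p))%R.

Lemma Lp_int_ge0 mu p f : 0 <= Lp_int mu p f.
Proof. by apply: Rintegral_ge0 => x _; exact: powR_ge0. Qed.

Lemma Lnorm_Lp_int mu p f A : 0 < p -> radon mu -> compact A ->
  bdd_supported_in f A ->
  Lnorm mu p%:E (EFin \o f) = (Lp_int mu p f `^ p^-1)%:E.
Proof.
move=> p0 rmu cA fA; rewrite unlock /Lp_int /Rintegral -poweR_EFin fineK//.
apply: integrable_fin_num => //; apply: bdd_supported_integrable rmu cA _.
exact: bdd_supported_powR.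
Qed.

End compact_support.

(** The rectangle of the supports has finite product measure, and [|K| <= 1 + K^2] there, so local
    square integrability suffices. The supports may overlap: this gives a meaning to the form near
    the diagonal. *)
Lemma integrable_kernel_prod (R : realType) (d : nat)
    (mu : {sigma_finite_measure set (Rd R d) -> \bar R})
    (nu : {sigma_finite_measure set (Rd R d) -> \bar R})
    (K : Rd R d * Rd R d -> R) (f g : Rd R d -> R) (A B : set 'rV[R]_d) :
  radon mu -> radon nu -> L2loc nu mu K -> compact A -> compact B ->
  bdd_supported_in f A -> bdd_supported_in g B ->
  (nu \x mu)%E.-integrable setT (EFin \o (fun z => K z * f z.2 * g z.1)).
Proof.
move=> rmu rnu [mK K2] cA cB [mf [[M fM] f0]] [mg [[N gN] g0]].
have mA := compact_measurable_Rd cA; have mB := compact_measurable_Rd cB.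
pose Q : set (Rd R d * Rd R d) := (B : set (Rd R d)) `*` (A : set (Rd R d)).
have mQ : measurable Q by exact: measurableX.
have Qoo : ((nu \x mu) Q < +oo)%E.
  by rewrite product_measure1E// lte_mul_pinfty// ?ge0_fin_numE// ?rmu ?rnu.
have iK2 : (nu \x mu)%E.-integrable Q (EFin \o (fun z => K z ^+ 2)).
  apply/integrableP; split.
    by apply/measurable_EFinP; apply: measurable_funTS; exact: measurable_funX.
  under eq_integral do rewrite /= normrX.
  exact: K2 (compact_setX cB cA).
have i1 : (nu \x mu)%E.-integrable Q (EFin \o cst 1).
  apply/integrableP; split; first exact/measurable_EFinP.
  by under eq_integral do rewrite /= normr1; rewrite integral_cst// mul1e.
have iG : (nu \x mu)%E.-integrable setT
    (EFin \o ((fun z => M * N * (1 + K z ^+ 2)) \_ Q)).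
  rewrite -restrict_EFin; apply/(integrable_mkcond _ mQ).
  apply: eq_integrable (integrableZl mQ (M * N) (integrableD mQ i1 iK2)) => //.
apply: integrable_le_norm iG _.
  apply: measurable_funM; first apply: measurable_funM => //.
    exact: measurableT_comp measurable_snd.
  exact: measurableT_comp measurable_fst.
move=> [x y]/=; rewrite /patch; case: ifPn => [|/negP nQ].
  move=> _; rewrite !normrM -mulrA mulrC.
  have K1 : `|K (x, y)| <= `|1 + K (x, y) ^+ 2|.
    rewrite [leRHS]ger0_norm ?addr_ge0 ?sqr_ge0// -real_normK ?num_real//.
    by have := sqr_ge0 (`|K (x, y)| - 1); nra.
  do 2 (apply: ler_pM => //); first exact: le_trans (fM _) (ler_norm _).
  exact: le_trans (gN _) (ler_norm _).
have [Bx|/g0 ->] := pselect ((B : set (Rd R d)) x); last by rewrite mulr0.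
have [Ay|/f0 ->] := pselect ((A : set (Rd R d)) y); last by rewrite mulr0 mul0r.
by exfalso; apply: nQ; rewrite inE.
Qed.

(** * The bilinear form on separated sets *)

(** The threshold 1/2 lies strictly between -1 and 1, so the indicators are eventually constant at
    each point; [(1 + r) / 2] is the indicator of [r = 1]. *)
Lemma cvg_indic_sign (R : realType) (T : Type) (h : nat -> T -> R) (r : T -> R) (x : T) :
  r x = 1 \/ r x = -1 -> h^~ x @ \oo --> r x ->
  \1_[set y | 1 / 2 <= h n y] x @[n --> \oo] --> (1 + r x) / 2.
Proof.
move=> r1 hr; apply: cvg_near_cst; case: r1 hr => -> hr.
  have : \forall n \near \oo, 1 / 2 < h n x by apply: (cvgr_gt _ hr); lra.
  apply: filterS => n hn; rewrite indicE mem_set; last exact: ltW.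
  by rewrite /=; lra.
have : \forall n \near \oo, h n x < 1 / 2 by apply: (cvgr_lt _ hr); lra.
apply: filterS => n hn; rewrite indicE memNset; last by apply/negP; rewrite -ltNge.
by rewrite /=; lra.
Qed.

Section restricted.
Context {R : realType} {d : nat}.
Context {mu nu : {sigma_finite_measure set (Rd R d) -> \bar R}}.
Context {p C : R} {K : Rd R d * Rd R d -> R}.
Hypotheses (rmu : radon mu) (rnu : radon nu) (p1 : 1 < p).
Hypotheses (KL2 : L2loc nu mu K) (C0 : 0 <= C).
Hypothesis Kpb : restrictedly_bounded mu nu p K C.

Notation q := (conj_exp p).

Let p0 : 0 < p. Proof. exact: lt_trans ltr01 p1. Qed.

Lemma conj_exp_gt0 : 0 < q. Proof. by rewrite divr_gt0// subr_gt0. Qed.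

Lemma conj_expV : p^-1 + q^-1 = 1.
Proof.
by rewrite /conj_exp; field; rewrite (gt_eqF p0)/= andbT subr_eq0 gt_eqF.
Qed.

(** Young's inequality replaces the product of norms by an expression linear in [|f|^p] and [|g|^q].
    Bounds on different pieces of [f] and [g] can then be added without loss. *)
Lemma restricted_young (f g : Rd R d -> R) (A B : set 'rV[R]_d) :
  compact A -> compact B -> A `&` B = set0 ->
  bdd_supported_in f A -> bdd_supported_in g B ->
  `| \int[(nu \x mu)%E]_z (K z * f z.2 * g z.1) |
    <= C * (Lp_int mu p f / p + Lp_int nu q g / q).
Proof.
move=> cA cB AB fA gB; have iK := integrable_kernel_prod rmu rnu KL2 cA cB fA gB.
rewrite -lee_fin EFin_normr_Rintegral//.
apply: (le_trans (Kpb cA cB AB fA gB)).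
rewrite (Lnorm_Lp_int p0 rmu cA)// (Lnorm_Lp_int conj_exp_gt0 rnu cB)//.
rewrite -!EFinM lee_fin -mulrA ler_wpM2l//.
apply: le_trans (conjugate_powR _ _ p0 conj_exp_gt0 conj_expV) _;
  rewrite ?powR_ge0//.
by rewrite -!powRrM !mulVf ?gt_eqF ?conj_exp_gt0// !powRr1 ?Lp_int_ge0.
Qed.

Lemma cvg_Lp_int_indic (m : {measure set (Rd R d) -> \bar R}) (s : R)
    (f r : Rd R d -> R) (A : set 'rV[R]_d) (h : nat -> 'rV[R]_d -> R) :
  0 < s -> radon m -> compact A -> bdd_supported_in f A ->
  (forall x, r x = 1 \/ r x = -1) -> (forall n, continuous (h n)) ->
  (forall x, h^~ x @ \oo --> r x) ->
  Lp_int m s (fun x : Rd R d => f x * \1_[set y : Rd R d | 1 / 2 <= h n y] x)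
    @[n --> \oo] --> (\int[m]_x (`|f x| `^ s * ((1 + r x) / 2)))%R.
Proof.
move=> s0 rm cA fA r1 ch hr.
pose D n := [set y : Rd R d | 1 / 2 <= h n y].
have mD n : measurable (D n).
  apply: (@closed_measurable_Rd _ _ [set y : 'rV[R]_d | 1 / 2 <= h n y]).
  exact: (closed_comp (fun x _ => ch n x) (@closed_ge _ _)).
have E n x : `|f x * \1_(D n) x| `^ s = `|f x| `^ s * \1_(D n) x.
  rewrite indicE; case: (_ \in _); first by rewrite !mulr1.
  by rewrite !mulr0 normr0 powR0// gt_eqF.
have [mf _] := bdd_supported_powR s0 fA.
rewrite /Lp_int; under eq_fun do under eq_Rintegral do rewrite E.
apply: (@cvg_Rintegral _ _ _ m _ _ (fun x => `|f x| `^ s)).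
- by move=> n; apply: measurable_funM => //; exact: measurable_indic.
- apply: bdd_supported_integrable rm cA _; exact: bdd_supported_powR.
- by move=> n x; rewrite normrM ler_piMr// indicE normr_nat; case: (_ \in _).
- by move=> x; apply: cvgM; [exact: cvg_cst|exact: cvg_indic_sign].
Qed.

Lemma restricted_baire_sign (f g r : Rd R d -> R) (A B : set 'rV[R]_d) :
  compact A -> compact B -> bdd_supported_in f A -> bdd_supported_in g B ->
  baire_sign r ->
  `| \int[(nu \x mu)%E]_z (K z * f z.2 * g z.1 *
       ((1 + r z.2) / 2 * ((1 - r z.1) / 2))) |
    <= C * ((\int[mu]_x (`|f x| `^ p * ((1 + r x) / 2))) / p +
            (\int[nu]_x (`|g x| `^ q * ((1 - r x) / 2))) / q).
Proof.
move=> cA cB fA gB sr; have mr := measurable_baire_sign sr.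
have [r1 [h [ch hr]]] := sr.
have Nr1 x : - r x = 1 \/ - r x = - 1.
  by case: (r1 x) => ->; rewrite ?opprK; auto.
have chN n : continuous (fun x => - h n x).
  by move=> x; apply: continuousN; exact: ch.
have hrN (x : Rd R d) : - h n x @[n --> \oo] --> - r x by exact: cvgN (hr x).
(* [A] and [B] may meet; the separation that the restricted bound requires comes from [D n] and
   [D' n], on which [h n] has opposite signs. *)
pose D n := [set y : 'rV[R]_d | 1 / 2 <= h n y].
pose D' n := [set y : 'rV[R]_d | 1 / 2 <= - h n y].
have cD n : closed (D n).
  exact: (closed_comp (fun x _ => ch n x) (@closed_ge _ _)).
have cD' n : closed (D' n).
  exact: (closed_comp (fun x _ => chN n x) (@closed_ge _ _)).
pose fn n (x : Rd R d) := f x * \1_(D n : set (Rd R d)) x.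
pose gn n (x : Rd R d) := g x * \1_(D' n : set (Rd R d)) x.
have bfn n : bdd_supported_in (fn n) (A `&` D n) by exact: bdd_supported_indic.
have bgn n : bdd_supported_in (gn n) (B `&` D' n) by exact: bdd_supported_indic.
have cAD n : compact (A `&` D n) by exact: compact_closedI.
have cBD n : compact (B `&` D' n) by exact: compact_closedI.
have bound n : `| \int[(nu \x mu)%E]_z (K z * fn n z.2 * gn n z.1) |
    <= C * (Lp_int mu p (fn n) / p + Lp_int nu q (gn n) / q).
  apply: (@restricted_young _ _ (A `&` D n) (B `&` D' n)) => //.
  rewrite -subset0 => x [[_ h1] [_ h2]]; move: h1 h2; rewrite /D /D' /=; lra.
have iK := integrable_kernel_prod rmu rnu KL2 cA cB fA gB.
have E n z : K z * fn n z.2 * gn n z.1 = K z * f z.2 * g z.1 *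
    (\1_(D n : set (Rd R d)) z.2 * \1_(D' n : set (Rd R d)) z.1).
  by rewrite /fn /gn; ring.
have cl : `| \int[(nu \x mu)%E]_z (K z * fn n z.2 * gn n z.1) | @[n --> \oo] -->
    `| \int[(nu \x mu)%E]_z (K z * f z.2 * g z.1 *
       ((1 + r z.2) / 2 * ((1 - r z.1) / 2))) |.
  apply: cvg_norm.
  apply: (@cvg_Rintegral _ _ _ (nu \x mu)%E _ _ (fun z => K z * f z.2 * g z.1)) => //.
  - move=> n; apply/measurable_EFinP.
    exact: measurable_int (integrable_kernel_prod rmu rnu KL2 (cAD n) (cBD n)
      (bfn n) (bgn n)).
  - move=> n z; rewrite E normrM ler_piMr// normrM !indicE !normr_nat.
    by case: (_ \in _); case: (_ \in _); rewrite ?mulr1 ?mulr0.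
  - move=> z; under eq_fun do rewrite E; apply: cvgM; first exact: cvg_cst.
    apply: cvgM; first exact: (cvg_indic_sign (r1 _) (hr _)).
    exact: (@cvg_indic_sign _ _ (fun n x => - h n x) (fun x => - r x) z.1
      (Nr1 _) (hrN _)).
have cr : C * (Lp_int mu p (fn n) / p + Lp_int nu q (gn n) / q) @[n --> \oo] -->
    C * ((\int[mu]_x (`|f x| `^ p * ((1 + r x) / 2))) / p +
         (\int[nu]_x (`|g x| `^ q * ((1 - r x) / 2))) / q).
  apply: cvgM; first exact: cvg_cst.
  apply: cvgD; apply: cvgM; try exact: cvg_cst.
    exact: (cvg_Lp_int_indic p0 rmu cA).
  exact: (@cvg_Lp_int_indic _ _ g (fun x => - r x) B (fun n x => - h n x) conj_exp_gt0).
by apply: (ler_cvg_to cl cr); apply: nearW => n; exact: bound.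
Qed.
End restricted.

(** * Averaging over signs *)

Lemma integrableM_le1 d (T : measurableType d) (R : realType)
    (mu : {measure set T -> \bar R}) (u k : T -> R) :
  mu.-integrable setT (EFin \o u) -> measurable_fun setT k ->
  (forall x, `|k x| <= 1) -> mu.-integrable setT (EFin \o (fun x => u x * k x)).
Proof.
move=> iu mk k1; apply: integrable_le_norm (iu) _.
  by apply: measurable_funM => //; apply/measurable_EFinP; exact: measurable_int iu.
by move=> x; rewrite normrM ler_piMr.
Qed.

Lemma countable_measure0 d (T : measurableType d) (R : realType)
    (mu : {measure set T -> \bar R}) (N : set T) :
  countable N -> (forall x, measurable [set x : T]) ->
  (forall x, N x -> mu [set x] = 0%E) -> mu.-negligible N.
Proof.
move=> /countable_injP[/= h hinj] m1 N0.
have -> : N = \bigcup_k (N `&` [set x | h x = k]).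
  by apply/seteqP; split=> [x Nx|x [k _ []//]]; exists (h x).
apply: negligible_bigcup => k.
have [[x [Nx hx]]|/forallNP e] := pselect (exists x, N x /\ h x = k).
  apply: (@negligibleS _ _ _ _ [set x]); last exact/negligibleP/N0.
  by move=> y [Ny hy]; apply: hinj; rewrite ?inE// hx hy.
by apply: negligibleS (@negligible_set0 _ _ _ mu) => x /e.
Qed.

Section sign_kernel.
Context {R : realType} {T : Type}.
Implicit Types s : nat -> T -> R.

(** For signs, each factor is 1 where [s i] agrees at the two points and 0 where it differs, so this
    is the indicator of the pairs not separated by the first [n] signs. *)
Definition sign_kernel s n (z : T * T) : R :=
  \prod_(i < n) ((1 + s i z.2 * s i z.1) / 2).

Lemma sign_kernelS s n z : sign_kernel s n.+1 z =
  sign_kernel s n z * ((1 + s n z.2 * s n z.1) / 2).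
Proof. by rewrite /sign_kernel big_ord_recr. Qed.

Lemma sign_kernel_ge0_le1 s n z : (forall i x, s i x = 1 \/ s i x = -1) ->
  0 <= sign_kernel s n z <= 1.
Proof.
move=> s1; elim: n => [|n /andP[n0 n1]]; first
  by rewrite /sign_kernel big_ord0 ler01 lexx.
rewrite sign_kernelS; case: (s1 n z.1) => ->; case: (s1 n z.2) => ->;
  by apply/andP; split; nra.
Qed.

Lemma cvg_sign_kernel s z : (forall i x, s i x = 1 \/ s i x = -1) ->
  (forall x y, x <> y -> exists i, s i x * s i y = -1) ->
  sign_kernel s n z @[n --> \oo] --> (\1_[set z : T * T | z.1 = z.2] z : R).
Proof.
move=> s1 sep; apply: cvg_near_cst; rewrite indicE.
have [zz|zz] := pselect (z.1 = z.2).
  rewrite mem_set//; apply: nearW => n; apply: big1 => i _; rewrite zz.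
  by case: (s1 i z.2) => ->; rewrite /=; lra.
rewrite memNset//; have [i si] := sep _ _ zz.
(* The vanishing factor of index [i] is present as soon as [n] is at least [i + 1]. *)
exists i.+1 => // n /= ni; rewrite /sign_kernel (bigD1 (Ordinal ni))//=.
by rewrite [s i _ * _]mulrC si; lra.
Qed.

End sign_kernel.

(** Pairs of a coordinate and a rational threshold are countable. The constant sign 1 at numbers
    coding no pair contributes a factor 1 to [sign_kernel]. *)
Definition halfspace_seq {R : realType} {d : nat} (n : nat) : Rd R d -> R :=
  if unpickle n is Some jq then halfspace_sign jq.1 jq.2 else fun=> 1.

Lemma baire_halfspace_seq (R : realType) (d : nat) n :
  baire_sign (@halfspace_seq R d n).
Proof.
rewrite /halfspace_seq; case: unpickle => [[j q]|]; last exact: baire_sign1.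
exact: baire_halfspace_sign.
Qed.

Lemma halfspace_seq_separates (R : realType) (d : nat) (x y : Rd R d) :
  x <> y -> exists i, halfspace_seq i x * halfspace_seq i y = -1.
Proof.
move=> /halfspace_sign_separates[j [q jq]]; exists (pickle (j, q)).
by rewrite /halfspace_seq pickleK.
Qed.

Lemma measurable_sign_kernel (R : realType) (d : nat) (s : nat -> Rd R d -> R) n :
  (forall i, baire_sign (s i)) -> measurable_fun setT (sign_kernel s n).
Proof.
move=> bs; apply: measurable_prod => i _.
have ms := measurable_baire_sign (bs i).
apply: measurable_funM => //; apply: measurable_funD => //; apply: measurable_funM.
  exact: measurableT_comp measurable_snd.
exact: measurableT_comp measurable_fst.
Qed.

(** * The bilinear form on arbitrary compact supports *)

Section bilinear.
Context {R : realType} {d : nat}.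
Context {mu nu : {sigma_finite_measure set (Rd R d) -> \bar R}}.
Context {p C : R} {K : Rd R d * Rd R d -> R}.
Hypotheses (rmu : radon mu) (rnu : radon nu) (p1 : 1 < p).
Hypotheses (KL2 : L2loc nu mu K) (C0 : 0 <= C).
Hypothesis Kpb : restrictedly_bounded mu nu p K C.
Context {f g : Rd R d -> R} {A B : set 'rV[R]_d}.
Hypotheses (cA : compact A) (cB : compact B).
Hypotheses (fA : bdd_supported_in f A) (gB : bdd_supported_in g B).

Notation q := (conj_exp p).
Let p0 : 0 < p. Proof. exact: lt_trans ltr01 p1. Qed.

Let Phi z := K z * f z.2 * g z.1.
Let iPhi : (nu \x mu)%E.-integrable setT (EFin \o Phi).
Proof. exact: integrable_kernel_prod cA cB fA gB. Qed.
Let c := 2 * C * (Lp_int mu p f / p + Lp_int nu q g / q).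

Lemma Lp_int_split (m : {measure set (Rd R d) -> \bar R}) s
    (u r : Rd R d -> R) (D : set 'rV[R]_d) :
  radon m -> compact D -> bdd_supported_in u D -> 0 < s -> baire_sign r ->
  Lp_int m s u = \int[m]_x (`|u x| `^ s * ((1 + r x) / 2)) +
                 \int[m]_x (`|u x| `^ s * ((1 - r x) / 2)).
Proof.
move=> rm cD uD s0 br; have mr := measurable_baire_sign br.
have [r1 _] := br.
have iu : m.-integrable setT (EFin \o (fun x => `|u x| `^ s)).
  by apply: bdd_supported_integrable rm cD _; exact: bdd_supported_powR.
rewrite -RintegralD//.
- by apply: eq_Rintegral => x _; rewrite -mulrDr -mulrDl addrACA subrr addr0 divff ?mulr1.
- apply: integrableM_le1 => //.
    by apply: measurable_funM => //; apply: measurable_funD.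
  by move=> x; case: (r1 x) => ->; rewrite ler_norml; apply/andP; split; lra.
- apply: integrableM_le1 => //.
    by apply: measurable_funM => //; apply: measurable_funB.
  by move=> x; case: (r1 x) => ->; rewrite ler_norml; apply/andP; split; lra.
Qed.

(** The weights [k1] and [k2] for [r] and [-r] sum to [(1 - r(x) r(y)) / 2], while the right-hand
    sides sum to the undivided Young bound. Clearing this half is the origin of the 2 in [2 * C]. *)
Lemma baire_sign_kernel r : baire_sign r ->
  `| \int[(nu \x mu)%E]_z (Phi z * (1 - r z.2 * r z.1)) | <= c.
Proof.
move=> br; have := baire_signN br => bNr.
have H1 := restricted_baire_sign rmu rnu p1 KL2 C0 Kpb cA cB fA gB br.
have H2 := restricted_baire_sign rmu rnu p1 KL2 C0 Kpb cA cB fA gB bNr.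
have [r1 _] := br; have mr := measurable_baire_sign br.
have mr1 : measurable_fun setT (fun z : Rd R d * Rd R d => r z.1).
  exact: measurableT_comp measurable_fst.
have mr2 : measurable_fun setT (fun z : Rd R d * Rd R d => r z.2).
  exact: measurableT_comp measurable_snd.
pose k1 z := (1 + r z.2) / 2 * ((1 - r z.1) / 2).
pose k2 z := (1 + - r z.2) / 2 * ((1 - - r z.1) / 2).
have i1 : (nu \x mu)%E.-integrable setT (EFin \o (fun z => Phi z * k1 z)).
  apply: integrableM_le1 => //.
    by apply: measurable_funM; apply: measurable_funM => //;
      [apply: measurable_funD|apply: measurable_funB].
  by move=> z; rewrite /k1; case: (r1 z.1) => ->; case: (r1 z.2) => ->;
    rewrite ler_norml; apply/andP; split; lra.
have i2 : (nu \x mu)%E.-integrable setT (EFin \o (fun z => Phi z * k2 z)).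
  apply: integrableM_le1 => //.
    by apply: measurable_funM; apply: measurable_funM => //;
      [apply: measurable_funB|apply: measurable_funB => //; exact: measurable_funN].
  by move=> z; rewrite /k2; case: (r1 z.1) => ->; case: (r1 z.2) => ->;
    rewrite ler_norml; apply/andP; split; lra.
rewrite (_ : Rintegral _ _ _ = 2 * (\int[(nu \x mu)%E]_z (Phi z * k1 z) +
                         \int[(nu \x mu)%E]_z (Phi z * k2 z))); last first.
  rewrite -RintegralD// -RintegralZl//.
    by apply: eq_Rintegral => z _; rewrite /k1 /k2; field.
  exact: eq_integrable (integrableD measurableT i1 i2).
rewrite normrM ger0_norm// /c -mulrA ler_wpM2l//.
apply: (le_trans (ler_normD _ _)); apply: (le_trans (lerD H1 H2)).
rewrite -mulrDr ler_wpM2l// (Lp_int_split rmu cA fA p0 br).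
rewrite (Lp_int_split rnu cB gB (conj_exp_gt0 p1) br).
rewrite le_eqVlt; apply/orP; left; apply/eqP.
under [X in (_ + _) + (_ + X / q)]eq_Rintegral do rewrite opprK.
by ring.
Qed.

(* The average for [n.+1] is the mean of those for [n] with [r] and [r * s n]. *)
Lemma sign_average (s : nat -> Rd R d -> R) n r :
  (forall i, baire_sign (s i)) -> baire_sign r ->
  `| \int[(nu \x mu)%E]_z (Phi z * (1 - r z.2 * r z.1 * sign_kernel s n z)) | <= c.
Proof.
move=> bs; elim: n r => [|n IH] r br.
  under eq_Rintegral do rewrite /sign_kernel big_ord0 mulr1.
  exact: baire_sign_kernel.
have H1 := IH _ br; have H2 := IH _ (baire_signM br (bs n)).
have s1 i x := (bs i).1 x.
have mk := measurable_sign_kernel n bs.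
have ik t : baire_sign t -> (nu \x mu)%E.-integrable setT
    (EFin \o (fun z => Phi z * (1 - t z.2 * t z.1 * sign_kernel s n z))).
  move=> bt; have mt := measurable_baire_sign bt.
  (* The kernel has modulus at most 2; moving that 2 onto [Phi] leaves [k] bounded by 1. *)
  have i0 : (nu \x mu)%E.-integrable setT
      (EFin \o (fun z => 2 * Phi z)).
    exact: eq_integrable (integrableZl measurableT 2 iPhi).
  pose k z := (1 - t z.2 * t z.1 * sign_kernel s n z) / 2.
  apply: eq_integrable (integrableM_le1 i0 (k := k) _ _) => //.
  - by move=> z _ /=; congr EFin; rewrite /k; field.
  - apply: measurable_funM => //; apply: measurable_funB => //.
    apply: measurable_funM => //; apply: measurable_funM.
      exact: measurableT_comp measurable_snd.
    exact: measurableT_comp measurable_fst.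
  - move=> z; have /andP[k0 k1] := sign_kernel_ge0_le1 n z s1; rewrite /k.
    by case: (bt.1 z.1) => ->; case: (bt.1 z.2) => ->;
      rewrite ler_norml; apply/andP; split; lra.
rewrite (_ : Rintegral _ _ _ = 2^-1 *
  (\int[(nu \x mu)%E]_z (Phi z * (1 - r z.2 * r z.1 * sign_kernel s n z)) +
   \int[(nu \x mu)%E]_z (Phi z * (1 - (r z.2 * s n z.2) * (r z.1 * s n z.1) *
      sign_kernel s n z)))); last first.
  have br' := baire_signM br (bs n).
  rewrite -RintegralD//; [|exact: ik|exact: (ik _ br')].
  rewrite -RintegralZl//; last first.
    exact: eq_integrable (integrableD measurableT (ik _ br) (ik _ br')).
  by apply: eq_Rintegral => z _; rewrite sign_kernelS; field.
rewrite normrM ger0_norm ?invr_ge0// mulrC ler_pdivrMr//.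
by apply: (le_trans (ler_normD _ _)); apply: (le_trans (lerD H1 H2)); lra.
Qed.

Let diag : set (Rd R d * Rd R d) := [set z | z.1 = z.2].

(** Measurability is for the product sigma-algebra, where it follows from the diagonal indicator
    being a pointwise limit of sign kernels. *)
Lemma measurable_indic_diag : measurable_fun setT (\1_diag : Rd R d * Rd R d -> R).
Proof.
have s1 i x := (@baire_halfspace_seq R d i).1 x.
apply: (@measurable_fun_cvg _ _ _ _ (sign_kernel (@halfspace_seq R d))).
  by move=> n; apply: measurable_sign_kernel => i; exact: baire_halfspace_seq.
by move=> z _; apply: cvg_sign_kernel => //; exact: halfspace_seq_separates.
Qed.

(** Start the average at [r = 1] and let [n] grow; [Phi] dominates, since the kernels stay between 0
    and 1. *)
Lemma bilinear_offdiag :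
  `| \int[(nu \x mu)%E]_z (Phi z * (1 - \1_diag z)) | <= c.
Proof.
pose s := @halfspace_seq R d.
have bs i : baire_sign (s i) by exact: baire_halfspace_seq.
have s1 i x := (bs i).1 x.
have cl : `| \int[(nu \x mu)%E]_z (Phi z * (1 - sign_kernel s n z)) | @[n --> \oo] -->
    `| \int[(nu \x mu)%E]_z (Phi z * (1 - \1_diag z)) |.
  apply: cvg_norm; apply: (@cvg_Rintegral _ _ _ (nu \x mu)%E _ _ Phi) => //.
  - move=> n; apply: measurable_funM.
      by apply/measurable_EFinP; exact: measurable_int iPhi.
    by apply: measurable_funB => //; exact: measurable_sign_kernel.
  - move=> n z; rewrite normrM ler_piMr//.
    by have /andP[] := sign_kernel_ge0_le1 n z s1; rewrite ler_norml; lra.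
  - move=> z; apply: cvgM; first exact: cvg_cst.
    apply: cvgB; first exact: cvg_cst.
    by apply: cvg_sign_kernel => //; exact: halfspace_seq_separates.
apply: (ler_cvg_to cl (cvg_cst c)); apply: nearW => n.
have := sign_average n bs baire_sign1.
by under eq_Rintegral do rewrite mulr1 mul1r.
Qed.

Hypothesis nca : no_common_atoms mu nu.

(** By Fubini, the slice at [x] only sees the point [y = x], so it vanishes unless [x] is an atom of
    [mu] lying in [A]. There are countably many such points because [mu A] is finite, and [nu]
    charges none of them. *)
Lemma integral_diag0 : \int[(nu \x mu)%E]_z (Phi z * \1_diag z) = 0.
Proof.
have mdiag := measurable_indic_diag.
have iD : (nu \x mu)%E.-integrable setT (EFin \o (fun z => Phi z * \1_diag z)).
  apply: integrableM_le1 => //.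
  by move=> z; rewrite indicE normr_nat; case: (_ \in _).
rewrite /Rintegral -[X in fine X](integral12_prod_meas1 iD).
rewrite (@ae_eq_integral _ _ _ nu setT (cst 0%E))// ?integral0//.
  exact: measurable_fubini_F iD.
pose N := [set x : Rd R d | A x /\ mu [set x] != 0%E].
have N0 : nu.-negligible N.
  apply: countable_measure0.
  - apply: countable_atoms; [exact: measurable_set1_Rd| |exact: rmu].
    exact: compact_measurable_Rd.
  - exact: measurable_set1_Rd.
  - by move=> x [_ mx]; case: (nca x) => // mx0; rewrite mx0 eqxx in mx.
case: N0 => M [mM M0 NM]; exists M; split=> //; apply: subset_trans NM => x /= Fx.
split; [apply: contrapT => nAx|apply/negP => /eqP mx]; apply: Fx => _.
  apply: integral0_eq => y _; rewrite /= indicE.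
  have [<-|xy] := pselect (x = y); first by rewrite /Phi /= (fA.2.2 x nAx) mulr0 !mul0r.
  by rewrite memNset// mulr0.
(* Here [mu [set x]] is 0, and the slice integrand is zero away from [x]. *)
rewrite -[RHS](@integral0 _ _ _ mu setT); apply: ae_eq_integral => //.
  by apply: measurableT_comp (measurable_int _ iD) _; exact: pair1_measurable.
exists [set x]; split=> //; first exact: measurable_set1_Rd.
move=> y /= yx; apply: contrapT => nyx; apply: yx => _.
by rewrite indicE memNset ?mulr0// => /= xy; apply: nyx.
Qed.

Lemma bilinear_young :
  `| \int[(nu \x mu)%E]_z (K z * f z.2 * g z.1) | <= c.
Proof.
have mdiag := measurable_indic_diag.
have dle z : `|\1_diag z : R| <= 1 by rewrite indicE normr_nat; case: (_ \in _).
have iD : (nu \x mu)%E.-integrable setT (EFin \o (fun z => Phi z * \1_diag z)).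
  exact: integrableM_le1.
have := bilinear_offdiag; rewrite (_ : Rintegral _ _ _ =
  \int[(nu \x mu)%E]_z (Phi z) - \int[(nu \x mu)%E]_z (Phi z * \1_diag z)).
  by rewrite integral_diag0 subr0.
rewrite -RintegralB//.
by apply: eq_Rintegral => z _; rewrite mulrBr mulr1.
Qed.

End bilinear.

(** * Duality *)

(** Undoes Young's inequality: the freedom in the scale [s] of the test function recovers the sharp
    multiplicative constant. Finiteness of [J] lets it be absorbed. *)
Lemma young_optimize (R : realType) (p c a J : R) : 1 < p -> 0 <= c -> 0 <= a -> 0 <= J ->
  (forall s, 0 < s -> s * J <= c * (a / p + s `^ conj_exp p * J / conj_exp p)) ->
  J <= c `^ p * a.
Proof.
move=> p1; rewrite le_eqVlt => /predU1P[<-|c0] a0 J0 H.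
  have := H 1 ltr01; rewrite mul0r mul1r => /le_trans; apply.
  by rewrite mulr_ge0 ?powR_ge0.
have p0 : 0 < p by lra.
(* With [s = c^(1-p)] and [q] the conjugate exponent, [c s^q = s]. The last term is then [s J / q],
   and subtracting it leaves [s J / p <= c a / p]. *)
have cP := powR_gt0 p c0; have := H (c `^ (1 - p)) (powR_gt0 _ c0).
have -> : c `^ (1 - p) `^ conj_exp p = (c `^ p)^-1.
  rewrite -powRrM -powRN; congr powR; rewrite /conj_exp; field.
  by rewrite subr_eq0 gt_eqF.
have -> : c `^ (1 - p) = c / c `^ p.
  by rewrite powRB ?powRr1 ?(ltW c0)// (gt_eqF c0) implybT.
set P := c `^ p in cP *; move=> {}H.
have qV : (conj_exp p)^-1 = 1 - p^-1 by have := conj_expV p1; lra.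
have {}H : J <= P * (a / p) + J * (1 - p^-1).
  have cPV : 0 < P / c by rewrite divr_gt0.
  have := ler_wpM2l (ltW cPV) H.
  rewrite (_ : P / c * (c / P * J) = J); last by field; rewrite !gt_eqF.
  rewrite qV (_ : P / c * (c * (a / p + P^-1 * J * (1 - p^-1))) =
    P * (a / p) + J * (1 - p^-1))//.
  by field; rewrite !gt_eqF.
have : J / p <= P * a / p by move: H; rewrite mulrBr mulr1 mulrA; lra.
by rewrite ler_pM2r ?invr_gt0.
Qed.

Section intop.
Context {R : realType} {d : nat}.
Context {mu : {sigma_finite_measure set (Rd R d) -> \bar R}}.
Context {K : Rd R d * Rd R d -> R} {f : Rd R d -> R}.
Hypotheses (mK : measurable_fun setT K) (mf : measurable_fun setT f).

Let k (z : Rd R d * Rd R d) := (K z * f z.2)%:E.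
Let mk : measurable_fun setT k.
Proof.
apply/measurable_EFinP; apply: measurable_funM => //.
exact: measurableT_comp measurable_snd.
Qed.

Lemma measurable_intop : measurable_fun setT (intop mu K f).
Proof.
have -> : intop mu K f = fine \o (fun x => fubini_F mu k^\+ x - fubini_F mu k^\- x)%E.
  apply/funext => x; rewrite /intop integralE; congr (fine (_ - _)).
    by apply: eq_integral => y _; rewrite !funeposE.
  by apply: eq_integral => y _; rewrite !funenegE.
apply: measurableT_comp => //; apply: emeasurable_funB.
  by apply: measurable_fun_fubini_tonelli_F => //; exact: measurable_funepos.
by apply: measurable_fun_fubini_tonelli_F => //; exact: measurable_funeneg.
Qed.

(* [intop] is 0 where the integral is not finite, whence the condition on [g]. *)
Lemma fubini_F_intop (g : Rd R d -> R) x : (intop mu K f x = 0 -> g x = 0) ->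
  fubini_F mu (fun z => (K z * f z.2 * g z.1)%:E) x = (g x * intop mu K f x)%:E.
Proof.
move=> g0; rewrite /fubini_F /=.
have mkx : measurable_fun setT (fun y => K (x, y) * f y).
  apply: measurable_funM => //; exact: measurableT_comp (pair1_measurable x).
have [fin|nfin] := boolP (\int[mu]_y (K (x, y) * f y)%:E \is a fin_num)%E.
  under eq_integral do rewrite mulrC EFinM.
  rewrite integralZl//; first by rewrite EFinM /intop fineK.
  apply/integrableP; split; first exact/measurable_EFinP.
  pose F y := (K (x, y) * f y)%:E.
  (* A finite difference of extended reals has both terms finite, so finiteness of the integral
     already gives integrability. *)
  have /andP[fp fn] : (\int[mu]_y F^\+ y \is a fin_num)%E &&
      (\int[mu]_y F^\- y \is a fin_num)%E by rewrite -fin_numB -integralE.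
  have absF y : `|F y|%E = (F^\+ y + F^\- y)%E.
    by rewrite -[LHS]/((abse \o F) y) fune_abse.
  rewrite [X in (X < _)%E](_ : _ = \int[mu]_y (F^\+ y + F^\- y))%E; last first.
    by apply: eq_integral => y _; exact: absF.
  rewrite ge0_integralD//; last 2 first.
    exact/measurable_funepos/measurable_EFinP.
    exact/measurable_funeneg/measurable_EFinP.
  rewrite -ge0_fin_numE; first by rewrite fin_numD fp.
  by apply: adde_ge0; exact: integral_ge0.
have h0 : intop mu K f x = 0.
  by rewrite /intop; move: nfin; case: (integral _ _ _).
by rewrite h0 g0// mulr0; under eq_integral do rewrite mulr0; rewrite integral0.
Qed.

End intop.

Section duality.
Context {R : realType} {d : nat}.
Context {mu nu : {sigma_finite_measure set (Rd R d) -> \bar R}}.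
Context {p C : R} {K : Rd R d * Rd R d -> R}.
Hypotheses (rmu : radon mu) (rnu : radon nu) (nca : no_common_atoms mu nu) (p1 : 1 < p).
Hypotheses (KL2 : L2loc nu mu K) (C0 : 0 <= C).
Hypothesis Kpb : restrictedly_bounded mu nu p K C.
Context {f : Rd R d -> R} {A : set 'rV[R]_d}.
Hypotheses (cA : compact A) (fA : bdd_supported_in f A).

Notation q := (conj_exp p).
Notation h := (intop mu K f).

Let p0 : 0 < p. Proof. exact: lt_trans ltr01 p1. Qed.
Let mh : measurable_fun setT h.
Proof. exact: measurable_intop KL2.1 fA.1. Qed.

(** Truncation to [D] makes the test function admissible and the integral of [|Tf|^p] finite a
    priori, as the absorption in [young_optimize] requires. *)
Lemma Lp_int_intop_trunc (D : set (Rd R d)) (B : set 'rV[R]_d) M :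
  compact B -> measurable D -> D `<=` B -> (forall x, D x -> `|h x| <= M) ->
  (\int[nu]_(x in D) (`|h x| `^ p)%:E <= ((2 * C) `^ p * Lp_int mu p f)%:E)%E.
Proof.
move=> cB mD DB hM; pose u x := h x * \1_D x.
have uh x : u x = h x \/ u x = 0.
  by rewrite /u indicE; case: (_ \in _); rewrite ?mulr1 ?mulr0; auto.
have mu_ : measurable_fun setT u by apply: measurable_funM => //; exact: measurable_indic.
have uB : bdd_supported_in u B.
  split=> //; split=> [|x nBx]; last by rewrite /u indicE memNset ?mulr0// => /DB.
  (* [M] may be negative when [D] is empty, hence the absolute value. *)
  exists `|M| => x; rewrite /u indicE; have [Dx|nDx] := pselect (D x).
    by rewrite mem_set// mulr1 (le_trans (hM _ Dx))// ler_norm.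
  by rewrite memNset// mulr0 normr0.
have iu : nu.-integrable setT (EFin \o (fun x => `|u x| `^ p)).
  by apply: bdd_supported_integrable rnu cB _; exact: bdd_supported_powR.
rewrite (_ : (\int[nu]_(x in D) _)%E = (Lp_int nu p u)%:E); last first.
  rewrite /Lp_int /Rintegral fineK; last exact: integrable_fin_num.
  rewrite [LHS]integral_mkcond; apply: eq_integral => x _; rewrite /patch.
  case: ifPn => xD; rewrite /u indicE; first by rewrite xD mulr1.
  by rewrite (negbTE xD) mulr0 normr0 powR0// gt_eqF.
rewrite lee_fin; apply: (young_optimize p1); rewrite ?mulr_ge0 ?Lp_int_ge0// => s s0.
(* The extremal function of Hölder's inequality: [g Tf = s |u|^p], and [|g|^q = s^q |u|^p] because
   [(p - 1) q = p]. Zeros of [u] are treated apart below, since [p - 2] may be negative. *)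
pose g x := s * (u x * `|u x| `^ (p - 2)).
have normg x : `|g x| = s * `|u x| `^ (p - 1).
  rewrite /g [LHS]normrM [`|u x * _|]normrM (ger0_norm (ltW s0)).
  rewrite [`| _ `^ _|]ger0_norm ?powR_ge0//.
  have [->|u0] := eqVneq (u x) 0.
    by rewrite normr0 mul0r powR0// gt_eqF// subr_gt0.
  rewrite (_ : p - 1 = 1 + (p - 2)); last by ring.
  by rewrite [in RHS]powRD ?powRr1// normr_eq0 u0 implybT.
have mg : measurable_fun setT g.
  apply: measurable_funM => //; apply: measurable_funM => //.
  by apply: (measurableT_comp (measurable_powR _)); exact: measurableT_comp.
have gB : bdd_supported_in g B.
  split=> //; case: uB => _ [[N uN] u0]; split.
    exists (s * N `^ (p - 1)) => x; rewrite normg ler_wpM2l ?(ltW s0)//.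
    by apply: ge0_ler_powR; rewrite ?nnegrE ?subr_ge0 ?(ltW p1)// (le_trans _ (uN x)).
  by move=> x /u0; rewrite /g => ->; rewrite mul0r mulr0.
have normgq x : `|g x| `^ q = s `^ q * `|u x| `^ p.
  rewrite normg powRM ?(ltW s0) ?powR_ge0// -powRrM; congr (_ * _ `^ _).
  by rewrite /conj_exp; field; rewrite subr_eq0 gt_eqF.
have gh x : g x * h x = s * `|u x| `^ p.
  have [ux|u0] := uh x; last first.
    by rewrite /g u0 mul0r mulr0 mul0r normr0 powR0 ?mulr0// gt_eqF.
  rewrite -ux /g; have [->|u0] := eqVneq (u x) 0.
    by rewrite mulr0 normr0 powR0 ?mulr0// gt_eqF.
  rewrite [in RHS](_ : p = 2%:R + (p - 2)); last by ring.
  rewrite [in RHS]powRD ?normr_eq0 ?u0 ?implybT// powR_mulrn// real_normK ?num_real//.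
  by ring.
have := bilinear_young rmu rnu p1 KL2 C0 Kpb cA cB fA gB nca.
have iPhi := integrable_kernel_prod rmu rnu KL2 cA cB fA gB.
rewrite /Rintegral -[X in fine X](integral12_prod_meas1 iPhi).
under eq_integral.
  move=> x _; rewrite fubini_F_intop//; [|exact: KL2.1|exact: fA.1|]; last first.
    by move=> hx; rewrite /g; have [->|->] := uh x; rewrite ?hx mul0r mulr0.
  rewrite gh; over.
rewrite -/(Rintegral _ _ _) RintegralZl// -/(Lp_int nu p u) => /(le_trans (ler_norm _)).
rewrite (_ : Lp_int nu q g = s `^ q * Lp_int nu p u)//.
rewrite /Lp_int -RintegralZl//; apply: eq_Rintegral => x _; exact: normgq.
Qed.

(** The truncated bounds are uniform, so monotone convergence along cubes of half-side [n] cut by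
    [|Tf| <= n] gives the bound on the whole space; then take [p]-th roots. *)
Lemma Lnorm_intop :
  (Lnorm nu p%:E (EFin \o h) <= (2 * C)%:E * Lnorm mu p%:E (EFin \o f))%E.
Proof.
rewrite (Lnorm_Lp_int p0 rmu cA fA) unlock.
set a := Lp_int mu p f; have a0 : 0 <= a by exact: Lp_int_ge0.
pose B n : set 'rV[R]_d := [set v | forall i, `[- n%:R, n%:R]%classic (v ord0 i)].
have cB n : compact (B n).
  exact: (@rV_compact R d (fun=> `[- n%:R, n%:R]%classic) (fun=> @segment_compact _ _ _)).
have mNh : measurable_fun setT (fun x => `|h x|) by exact: measurableT_comp.
pose D n : set (Rd R d) :=
  (B n : set (Rd R d)) `&` (fun x => `|h x|) @^-1` `]-oo, n%:R]%classic.
have hD n x : D n x -> `|h x| <= n%:R by move=> [_]; rewrite /= in_itv.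
have mD n : measurable (D n).
  apply: measurableI; first exact: compact_measurable_Rd.
  by rewrite -[X in measurable X]setTI; apply: mNh.
have mhp : measurable_fun setT (fun x => (`|h x| `^ p)%:E).
  by apply/measurable_EFinP; exact: (measurableT_comp (measurable_powR p)).
have bound n : (\int[nu]_(x in D n) (`|h x| `^ p)%:E <= ((2 * C) `^ p * a)%:E)%E.
  by apply: (Lp_int_intop_trunc (cB n) (mD n)) => [x []|x /hD] //; exact.
have ndD : nondecreasing_seq D.
  move=> m n mn; rewrite subsetEset => x [Bx hx].
  have mn' : m%:R <= n%:R :> R by rewrite ler_nat.
  split; last by move: hx; rewrite /= !in_itv/= => /le_trans; apply.
  move=> i; have := Bx i; rewrite /= !in_itv/= => /andP[x1 x2].
  by rewrite (le_trans x2)// (le_trans _ x1)// lerN2.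
have UD : \bigcup_n D n = setT.
  apply/seteqP; split=> // x _.
  (* One number dominating both [|Tf(x)|] and every coordinate of [x]. *)
  pose b := `|h x| + \sum_i `|(x : 'rV[R]_d) ord0 i|.
  have [n _ bn] := nbhs_infty_ger b.
  have {}bn := bn n (leqnn n); exists n => //; split.
    move=> i; rewrite /= in_itv/= -ler_norml; apply: le_trans bn.
    rewrite /b (bigD1 i)//= addrCA lerDl addr_ge0// sumr_ge0//.
  by rewrite /= in_itv/=; apply: le_trans bn; rewrite lerDl sumr_ge0.
have hb : (\int[nu]_x (`|h x| `^ p)%:E <= ((2 * C) `^ p * a)%:E)%E.
  have c : (\int[nu]_(x in D n) (`|h x| `^ p)%:E @[n --> \oo] -->
      \int[nu]_x (`|h x| `^ p)%:E)%E.
    rewrite -UD; apply: ge0_nondecreasing_set_cvg_integral => //.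
      by move=> n; exact: measurable_funTS.
  rewrite -(cvg_lim _ c)//; apply: lime_le; first by apply/cvg_ex; eexists; exact: c.
  by apply: nearW => n; exact: bound.
rewrite /=.
apply: (le_trans (gt0_ler_poweR _ _ _ hb)).
- by rewrite invr_ge0 ltW.
- by rewrite in_itv/= leey andbT integral_ge0// => x _; rewrite lee_fin powR_ge0.
- by rewrite in_itv/= leey andbT lee_fin mulr_ge0 ?powR_ge0.
rewrite poweR_EFin -EFinM lee_fin powRM ?powR_ge0// -powRrM mulfV ?gt_eqF//.
by rewrite powRr1// mulr_ge0.
Qed.

End duality.

Theorem theorem3p2 (R : realType) (d : nat)
    (mu : {sigma_finite_measure set (Rd R d) -> \bar R})
    (nu : {sigma_finite_measure set (Rd R d) -> \bar R})
    (p : R) (K : Rd R d * Rd R d -> R) (C : R) :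
  radon mu -> radon nu -> no_common_atoms mu nu ->
  1 < p ->
  L2loc nu mu K ->
  0 <= C -> restrictedly_bounded mu nu p K C ->
  forall (f : Rd R d -> R) (A : set 'rV[R]_d),
    compact A -> bdd_supported_in f A ->
    (Lnorm nu p%:E (EFin \o intop mu K f)
      <= (2 * C)%:E * Lnorm mu p%:E (EFin \o f))%E.
Proof.
move=> rmu rnu nca p1 KL2 C0 Kpb f A cA fA.
exact: (Lnorm_intop rmu rnu nca p1 KL2 C0 Kpb cA fA).
Qed.
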